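(* The $\mathbb{Z}$-graded derivation algebra $\mathrm{Der}\,\mathcal{B}=\bigoplus_{\alpha\in\mathbb{Z}}(\mathrm{Der}\,\mathcal{B})_\alpha$ of the Lie algebra $\mathcal{B}$ has the decomposition $$\mathrm{Der}\,\mathcal{B}=\mathrm{ad}\,\mathcal{B}\oplus \mathrm{D},\qquad \mathrm{D}=\mathrm{span}\{d_0\},$$ where $d_0$ is the derivation of $\mathcal{B}$ given by $d_0(L_{\beta,j})=\beta L_{\beta,j}$ for $\beta\in\mathbb{Z}$, $j\in\mathbb{Z}_+$. In particular, the first cohomology group $H^1(\mathcal{B})=\mathrm{Der}\,\mathcal{B}/\mathrm{ad}\,\mathcal{B}$ is one-dimensional, i.e. $\dim H^1(\mathcal{B})=1$.
   Context: Let $\mathbb{F}$ be an algebraically closed field of characteristic zero and $\mathbb{Z}_+=\{0,1,2,\dots\}$. $\mathcal{B}$ is the Lie algebra over $\mathbb{F}$ with basis $\{L_{\alpha,i}\mid \alpha\in\mathbb{Z},\, i\in\mathbb{Z}_+\}$ and bracket $$[L_{\alpha,i},L_{\beta,j}]=\big((\alpha-1)(j+1)-(\beta-1)(i+1)\big)L_{\alpha+\beta,i+j}.$$ A derivation of $\mathcal{B}$ is a linear map $d:\mathcal{B}\to\mathcal{B}$ with $d([x,y])=[d(x),y]+[x,d(y)]$ for all $x,y\in\mathcal{B}$. $\mathrm{Der}\,\mathcal{B}$ is the Lie algebra of all derivations and $\mathrm{ad}\,\mathcal{B}=\{\mathrm{ad}_u\mid u\in\mathcal{B}\}$ is the ideal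 of inner derivations, where $\mathrm{ad}_u(v)=[u,v]$. $\mathcal{B}=\bigoplus_{\alpha\in\mathbb{Z}}\mathcal{B}_\alpha$ is $\mathbb{Z}$-graded with $\mathcal{B}_\alpha=\mathrm{span}\{L_{\alpha,i}\mid i\in\mathbb{Z}_+\}$, and $(\mathrm{Der}\,\mathcal{B})_\alpha=\{d\in\mathrm{Der}\,\mathcal{B}\mid d(\mathcal{B}_\beta)\subset\mathcal{B}_{\alpha+\beta}\text{ for all }\beta\in\mathbb{Z}\}$. *)

(* Defs.v *)
From HB Require Import structures.
From mathcomp Require Import all_boot all_algebra.
From mathcomp Require Import finmap multinomials.monalg.
From mathcomp Require Import boolp classical_sets functions ring.

Set Implicit Arguments.
Unset Strict Implicit.
Unset Printing Implicit Defensive.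

Import GRing.Theory.

Local Open Scope fset_scope.
Local Open Scope quotient_scope.
Local Open Scope classical_set_scope.
Local Open Scope ring_scope.

Section LinearAlgebra.
Variables (F : fieldType) (V : lmodType F).

Definition span (I : Type) (v : I -> V) : set V :=
  [set x | exists s : seq (F * I), x = \sum_(p <- s) p.1 *: v p.2].

Definition direct_sum (I : choiceType) (U : I -> set V) : Prop :=
  forall v : V, exists! c : {fsfun I -> V with 0},
    (forall i, U i (c i)) /\ v = \sum_(i <- finsupp c) c i.

Definition direct_sum2 (U W : set V) : Prop :=
  forall v : V, exists! p : V * V, [/\ U p.1, W p.2 & v = p.1 + p.2].

Definition has_dim (n : nat) : Prop :=
  exists f : {linear V -> 'rV[F]_n}, bijective f.

End LinearAlgebra.

(* MathComp only provides the additive group structure on quotients of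
   modules; the scalar multiplication is added here. *)
Section QuotientModule.
Variables (F : fieldType) (V : lmodType F) (W : submodClosed V).

(* W itself: the zmodClosed structure required by Quotient is not inferred
   from a submodClosed one. *)
Definition quot_pred : {pred V} := fun v => v \in W.

Lemma quot_pred_zmod_closed : zmod_closed quot_pred.
Proof.
split=> [|u v uW vW]; first exact: (rpred0 W).
by rewrite -scaleN1r; apply: (rpredD uW); apply: rpredZ.
Qed.
HB.instance Definition _ :=
  GRing.isZmodClosed.Build V quot_pred quot_pred_zmod_closed.

Definition quotmod : Type := Quotient.quot quot_pred.
HB.instance Definition _ := GRing.Zmodule.on quotmod.

Definition quotmod_pi (v : V) : quotmod := \pi_(Quotient.quot quot_pred) v.
Definition quotmod_scale (a : F) (x : quotmod) : quotmod :=
  quotmod_pi (a *: repr (x : Quotient.quot quot_pred)).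

Lemma quotmod_piP (u v : V) : quotmod_pi u = quotmod_pi v <-> u - v \in W.
Proof. rewrite -[_ \in W]/(_ \in quot_pred).
by rewrite Quotient.idealrBE; split=> /eqP. Qed.

Lemma quotmod_piD (u v : V) : quotmod_pi (u + v) = quotmod_pi u + quotmod_pi v.
Proof. exact: (@Quotient.pi_add V quot_pred u v). Qed.

Lemma quotmod_repr (x : quotmod) :
  quotmod_pi (repr (x : Quotient.quot quot_pred)) = x.
Proof. exact: reprK. Qed.

Lemma quotmod_piZ (a : F) (v : V) :
  quotmod_pi (a *: v) = quotmod_scale a (quotmod_pi v).
Proof.
apply/quotmod_piP; rewrite -scalerBr rpredZ //.
by apply/quotmod_piP; rewrite quotmod_repr.
Qed.

Lemma quotmod_scaleA a b x :
  quotmod_scale a (quotmod_scale b x) = quotmod_scale (a * b) x.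
Proof. by rewrite -[x]quotmod_repr -!quotmod_piZ scalerA. Qed.

Lemma quotmod_scale1 : left_id 1 quotmod_scale.
Proof. by move=> x; rewrite -[x]quotmod_repr -!quotmod_piZ scale1r. Qed.

Lemma quotmod_scaleDr : right_distributive quotmod_scale +%R.
Proof.
move=> a x y; rewrite -[x]quotmod_repr -[y]quotmod_repr.
by rewrite -quotmod_piD -!quotmod_piZ -quotmod_piD scalerDr.
Qed.

Lemma quotmod_scaleDl x : {morph quotmod_scale^~ x : a b / a + b}.
Proof.
by move=> a b; rewrite -[x]quotmod_repr -!quotmod_piZ -quotmod_piD scalerDl.
Qed.

HB.instance Definition _ := GRing.Zmodule_isLmodule.Build F quotmod
  quotmod_scaleA quotmod_scale1 quotmod_scaleDr quotmod_scaleDl.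

End QuotientModule.

Lemma linZ (F : fieldType) (U V : lmodType F) (f : U -> V) :
  linear f -> forall a x, f (a *: x) = a *: f x.
Proof.
move=> fl; have f0 : f 0 = 0 by have := fl (-1) 0 0; rewrite !scaleN1r !addNr.
by move=> a x; have := fl a x 0; rewrite f0 !addr0.
Qed.

Lemma linB (F : fieldType) (U V : lmodType F) (f : U -> V) :
  linear f -> {morph f : x y / x - y}.
Proof. by move=> fl x y; rewrite addrC -scaleN1r fl scaleN1r addrC. Qed.

Section LinearExtension.
Variables (F : fieldType) (K : choiceType) (V : lmodType F).

Definition lext (f : K -> V) (x : {malg F[K]}) : V :=
  \sum_(k <- msupp x) x@_k *: f k.

Lemma lextEw (f : K -> V) (x : {malg F[K]}) (S : {fset K}) :
  (msupp x `<=` S)%fset -> lext f x = \sum_(k <- S) x@_k *: f k.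
Proof.
move=> sxS; apply: big_fset_incl => // k _ kx.
by rewrite mcoeff_outdom ?scale0r.
Qed.

Lemma lext_linear (f : K -> V) : linear (lext f).
Proof.
move=> a x y; pose S := (msupp x `|` msupp y `|` msupp (a *: x + y))%fset.
rewrite !(@lextEw _ _ S) ?fsubsetUr //; first last.
- by rewrite /S -fsetUA fsubsetUl.
- by rewrite /S -fsetUA fsetUCA fsubsetUl.
rewrite scaler_sumr -big_split /=; apply: eq_bigr => k _.
by rewrite mcoeffD mcoeffZ scalerDl scalerA.
Qed.

Lemma lextU (f : K -> V) (k : K) : lext f << k >> = f k.
Proof.
rewrite (@lextEw _ _ [fset k]%fset) ?msuppU_le // big_seq_fset1.
by rewrite mcoeffUU scale1r.
Qed.

Lemma monalgUZ (c : F) (k : K) : << c *g k >> = c *: << k >> :> {malg F[K]}.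
Proof. by apply/malgP=> l; rewrite mcoeffZ !mcoeffU mulrnAr mulr1. Qed.

End LinearExtension.

HB.mixin Record Lmodule_isLieAlgebra (F : fieldType) V of GRing.Lmodule F V := {
  lie : V -> V -> V;
  lie_linearl : forall y, linear (lie^~ y);
  lie_linearr : forall x, linear (lie x);
  lie_alt : forall x, lie x x = 0;
  lie_jacobi : forall x y z,
    lie x (lie y z) + lie y (lie z x) + lie z (lie x y) = 0
}.

#[short(type="lieAlgType")]
HB.structure Definition LieAlgebra (F : fieldType) :=
  {V of Lmodule_isLieAlgebra F V & GRing.Lmodule F V}.

Section Derivations.
Variables (F : fieldType) (B : lieAlgType F).
Implicit Types x y z u v : B.

Lemma lie0l y : lie 0 y = 0.
Proof. by have := linZ (lie_linearl y) 0 0; rewrite !scale0r. Qed.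

Lemma lie0r x : lie x 0 = 0.
Proof. by have := linZ (lie_linearr x) 0 0; rewrite !scale0r. Qed.

Lemma lie_antisym x y : lie x y = - lie y x.
Proof.
have D1 u v w : lie (u + v) w = lie u w + lie v w.
  by have := lie_linearl w 1 u v; rewrite !scale1r.
have D2 u v w : lie u (v + w) = lie u v + lie u w.
  by have := lie_linearr u 1 v w; rewrite !scale1r.
apply/eqP; rewrite -addr_eq0; apply/eqP.
by have := lie_alt (x + y); rewrite D1 !D2 !lie_alt add0r addr0.
Qed.

Definition is_derivation (d : B -> B) : Prop :=
  linear d /\ forall x y, d (lie x y) = lie (d x) y + lie x (d y).

Definition derivations : {pred B -> B} := [pred d | `[< is_derivation d >]].

Lemma derivations_submod_closed : submod_closed derivations.
Proof.
split=> [|c d e /asboolP[dl dD] /asboolP[el eD]]; apply/asboolP; split.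
- by move=> a x y; rewrite /= scaler0 addr0.
- by move=> x y; rewrite lie0l lie0r addr0.
- move=> a x y; have E z : (c *: d + e) z = c *: d z + e z by [].
  by rewrite !E dl el !scalerDr !scalerA [c * a]mulrC addrACA.
- move=> x y; have E z : (c *: d + e) z = c *: d z + e z by [].
  by rewrite !E dD eD scalerDr lie_linearl lie_linearr addrACA.
Qed.
HB.instance Definition _ :=
  GRing.isSubmodClosed.Build F (B -> B) derivations derivations_submod_closed.

Record Der := MkDer { der_fun :> B -> B; derP : der_fun \in derivations }.
HB.instance Definition _ := [isSub for der_fun].
HB.instance Definition _ := [Choice of Der by <:].
HB.instance Definition _ := [SubChoice_isSubLmodule of Der by <:].

Lemma der_comm_derivation (d e : Der) :
  (fun x => d (e x) - e (d x)) \in derivations.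
Proof.
case: d e => [d /asboolP[dl dD]] [e /asboolP[el eD]] /=.
have addl (f : B -> B) : linear f -> {morph f : x y / x + y}.
  by move=> fl x y; have := fl 1 x y; rewrite !scale1r.
have lieBl x y z : lie (x - y) z = lie x z - lie y z.
  exact: (linB (lie_linearl z) x y).
have lieBr x y z : lie x (y - z) = lie x y - lie x z.
  exact: (linB (lie_linearr x) y z).
apply/asboolP; split=> [a x y|x y].
  by rewrite el !dl el scalerBr opprD addrACA.
rewrite dD eD (addl _ dl) (addl _ el) !dD !eD lieBl lieBr.
rewrite [lie (d x) (e y) + _]addrC [lie (e x) (d y) + _]addrC.
rewrite [X in X - _]addrACA [X in _ - X]addrACA [X in _ - (_ + X)]addrC.
by rewrite opprD [LHS]addrACA subrr addr0 opprD [LHS]addrACA.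
Qed.
Definition der_comm (d e : Der) : Der := MkDer (der_comm_derivation d e).

Lemma ad_derivation u : lie u \in derivations.
Proof.
apply/asboolP; split=> [|x y]; first exact: lie_linearr.
have := lie_jacobi u x y.
rewrite (lie_antisym y u) (lie_antisym y (lie u x)) -scaleN1r.
rewrite (linZ (lie_linearr x)) scaleN1r -addrA -opprD => /subr0_eq ->.
exact: addrC.
Qed.
Definition ad u : Der := MkDer (ad_derivation u).

Definition adB : set Der := range ad.

Definition inner_pred : {pred Der} := [pred d | d \in adB].

Lemma inner_submod_closed : submod_closed inner_pred.
Proof.
split=> [|c d e]; rewrite !inE.
  by exists 0 => //; apply/val_inj/funext => x /=; rewrite lie0l.
move=> [u _ <-] [v _ <-]; exists (c *: u + v) => //.
by apply/val_inj/funext => x /=; rewrite lie_linearl.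
Qed.
HB.instance Definition _ :=
  GRing.isSubmodClosed.Build F Der inner_pred inner_submod_closed.

Definition H1 : lmodType F := quotmod inner_pred.

End Derivations.

Arguments derivations {F} B.
Arguments inner_pred {F} B.
Arguments adB {F} B.

(* Identities for a bilinear product given on a spanning family, stated for an
   abstract module to keep unification away from the structure of {malg _}. *)
Section SpanningFamily.
Variables (F : fieldType) (V : lmodType F) (e : int -> nat -> V).
Hypothesis e_ind : forall P : V -> Prop, P 0 -> (forall a i, P (e a i)) ->
  (forall c x y, P x -> P y -> P (c *: x + y)) -> forall x, P x.
Variable br : V -> V -> V.
Hypothesis br_linearl : forall y, linear (br^~ y).
Hypothesis br_linearr : forall x, linear (br x).
Hypothesis br_e : forall a i b j, br (e a i) (e b j) =
  ((a - 1) * (j.+1)%:Z - (b - 1) * (i.+1)%:Z)%:~R *: e (a + b) (i + j).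

Let br0l y : br 0 y = 0.
Proof. by have := linZ (br_linearl y) 0 0; rewrite !scale0r. Qed.
Let br0r x : br x 0 = 0.
Proof. by have := linZ (br_linearr x) 0 0; rewrite !scale0r. Qed.
Let brZl y a x : br (a *: x) y = a *: br x y.
Proof. exact: (linZ (br_linearl y)). Qed.
Let brZr x a y : br x (a *: y) = a *: br x y.
Proof. exact: (linZ (br_linearr x)). Qed.
Let brE := (br_linearl, br_linearr).

Lemma br_antisym x y : br x y = - br y x.
Proof.
elim/e_ind: x => [|a i|c u v IHu IHv]; first by rewrite br0l br0r oppr0.
  elim/e_ind: y => [|b j|c u v IHu IHv]; first by rewrite br0l br0r oppr0.
    by rewrite !br_e [b + a]addrC [(j + i)%N]addnC -scaleNr -rmorphN opprB.
  by rewrite !brE IHu IHv opprD scalerN.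
by rewrite !brE IHu IHv opprD scalerN.
Qed.

Lemma br_alt x : br x x = 0.
Proof.
elim/e_ind: x => [|a i|c u v IHu IHv]; first exact: br0l.
  by rewrite br_e subrr scale0r.
by rewrite br_linearl !br_linearr IHu IHv (br_antisym u v) scaler0 add0r addr0
  scalerN addNr.
Qed.

Lemma br_jacobi x y z :
  br x (br y z) + br y (br z x) + br z (br x y) = 0.
Proof.
have ad3 c (p q r p' q' r' : V) : p + q + r = 0 -> p' + q' + r' = 0 ->
    c *: p + p' + (c *: q + q') + (c *: r + r') = 0.
  move=> h h'; rewrite [X in X + _]addrACA [LHS]addrACA h'.
  by rewrite -!scalerDr h scaler0 addr0.
elim/e_ind: x => [|a i|c u v IHu IHv]; first 1 last.
- elim/e_ind: y => [|b j|c u v IHu IHv]; first 1 last.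
  + elim/e_ind: z => [|c k|c u v IHu IHv]; first 1 last.
    * rewrite !br_e !brZr !br_e !scalerA.
      rewrite [c + a]addrC [b + (a + c)]addrCA [c + (a + b)]addrCA [c + b]addrC.
      rewrite [(k + i)%N]addnC [(j + (i + k))%N]addnCA [(k + (i + j))%N]addnCA.
      rewrite [(k + j)%N]addnC -!scalerDl -!rmorphM -!rmorphD /=.
      set s := (X in X%:~R); suff -> : s = 0 by rewrite scale0r.
      rewrite /s !intS !PoszD; ring.
    * by rewrite !brE; apply: ad3.
    * by rewrite !(br0l, br0r) !addr0.
  + by rewrite !brE; apply: ad3.
  + by rewrite !(br0l, br0r) !addr0.
- by rewrite !brE; apply: ad3.
- by rewrite !(br0l, br0r) !addr0.
Qed.

Lemma degree_derivation (d : V -> V) : linear d ->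
  (forall a i, d (e a i) = a%:~R *: e a i) ->
  forall x y, d (br x y) = br (d x) y + br x (d y).
Proof.
move=> dl de x y.
have d00 : d 0 = 0 by have := linZ dl 0 0; rewrite !scale0r.
elim/e_ind: x => [|a i|c u v IHu IHv]; first 1 last.
- elim/e_ind: y => [|b j|c u v IHu IHv]; first 1 last.
  + rewrite !de brZl brZr br_e (linZ dl) de !scalerA -scalerDl.
    by rewrite -mulrDl -rmorphD /= mulrC.
  + by rewrite br_linearr !dl !br_linearr IHu IHv scalerDr addrACA.
  + by rewrite !(d00, br0l, br0r) addr0.
- by rewrite br_linearl !dl !br_linearl IHu IHv scalerDr addrACA.
- by rewrite !(d00, br0l, br0r) addr0.
Qed.

End SpanningFamily.

Definition algB (F : fieldType) := {malg F[(int * nat)%type]}.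

Definition L {F : fieldType} (a : int) (i : nat) : algB F := << (a, i) >>.

Section AlgebraB.
Variable F : fieldType.
Local Notation B := (algB F).

HB.instance Definition _ := GRing.Lmodule.on B.

Lemma algB_ind (P : B -> Prop) :
  P 0 -> (forall a i, P (L a i)) ->
  (forall c x y, P x -> P y -> P (c *: x + y)) -> forall x, P x.
Proof.
move=> P0 PL PD x; rewrite [x]monalgE; elim/big_rec: _ => // -[a i] y _ Py.
by rewrite monalgUZ; apply: (PD _ (L a i)); first exact: PL.
Qed.

Definition algB_lie_basis (k l : int * nat) : B :=
  ((k.1 - 1) * (l.2.+1)%:Z - (l.1 - 1) * (k.2.+1)%:Z)%:~R
    *: L (k.1 + l.1) (k.2 + l.2).

Definition algB_lie (x y : B) : B :=
  lext (fun k => lext (fun l => algB_lie_basis k l) y) x.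

Lemma algB_lieL a i b j :
  algB_lie (L a i) (L b j) =
  ((a - 1) * (j.+1)%:Z - (b - 1) * (i.+1)%:Z)%:~R *: L (a + b) (i + j).
Proof. by rewrite /algB_lie !lextU. Qed.

Lemma algB_lie_linearl (y : B) : linear (algB_lie^~ y).
Proof. exact: lext_linear. Qed.

Lemma algB_lie_linearr (x : B) : linear (algB_lie x).
Proof.
move=> a y z; rewrite /algB_lie /lext scaler_sumr -big_split /=.
apply: eq_bigr => k _; rewrite -!/(lext _ _) lext_linear scalerDr !scalerA.
by rewrite mulrC.
Qed.

HB.instance Definition _ := Lmodule_isLieAlgebra.Build F B
  algB_lie_linearl algB_lie_linearr
  (br_alt algB_ind algB_lie_linearl algB_lie_linearr algB_lieL)
  (br_jacobi algB_ind algB_lie_linearl algB_lie_linearr algB_lieL).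

Lemma lie_L a i b j :
  lie (L a i : B) (L b j) =
  ((a - 1) * (j.+1)%:Z - (b - 1) * (i.+1)%:Z)%:~R *: L (a + b) (i + j).
Proof. exact: algB_lieL. Qed.

Definition B_ (a : int) : set B := span (fun i => L a i).

Definition Der_ (a : int) : set (Der B) :=
  [set d | forall b x, B_ b x -> B_ (a + b) (d x)].

Definition d0_fun : B -> B := lext (fun k => (k.1)%:~R *: L k.1 k.2).

Lemma d0_funL a i : d0_fun (L a i) = a%:~R *: L a i.
Proof. by rewrite /d0_fun lextU. Qed.

Lemma d0_derivation : d0_fun \in derivations B.
Proof.
have d0_linear : linear d0_fun by exact: lext_linear.
apply/asboolP; split=> //.
exact: (degree_derivation algB_ind algB_lie_linearl algB_lie_linearr algB_lieL
  d0_linear d0_funL).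
Qed.
Definition d0 : Der B := MkDer d0_derivation.

Definition D : set (Der B) := span (fun _ : unit => d0).

End AlgebraB.

Arguments B_ F a : clear implicits.
Arguments Der_ F a : clear implicits.
Arguments D F : clear implicits.

(* Main.v *)
(** The element t = L 0 0 acts diagonally, L a i having eigenvalue -(a + i). Given
    a derivation d, subtracting an inner derivation removes the components of d t
    of nonzero eigenvalue; as d t then has to commute with L 1 0, it vanishes and
    d preserves n = a + i. A second inner derivation, by an element
    with n = 0, kills d (L 1 0). The Leibniz rule is then, for each shift s
    of the index i, a recurrence on the coefficients of d, whose only solution is
    a multiple of L a i |-> i L a i, that is of -(ad t + d0). The multiple of d0
    in a derivation can be read off from two coefficients, which gives a linear
    form on Der with kernel ad B. *)

Require Import Defs.
From HB Require Import structures.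
From mathcomp Require Import all_boot all_algebra.
From mathcomp Require Import finmap multinomials.monalg.
From mathcomp Require Import boolp classical_sets functions.
From mathcomp Require Import zify ring.

Import GRing.Theory.
Local Open Scope ring_scope.

(** * Derivations of a general Lie algebra *)

Section DerivationTheory.
Variables (F : fieldType) (B : lieAlgType F).
Implicit Types (d e : Der B) (x y u v : B).

Lemma der_linear d : linear d.
Proof. by have /asboolP[] := derP d. Qed.

Lemma der0 d : d 0 = 0.
Proof. by have := linZ (der_linear d) 0 0; rewrite !scale0r. Qed.

Lemma derZ d c x : d (c *: x) = c *: d x.
Proof. exact: (linZ (der_linear d)). Qed.

Lemma derM d x y : d (lie x y) = lie (d x) y + lie x (d y).
Proof. by have /asboolP[_] := derP d. Qed.

Lemma addDerE d e x : (d + e) x = d x + e x. Proof. by []. Qed.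
Lemma subDerE d e x : (d - e) x = d x - e x. Proof. by []. Qed.
Lemma scaleDerE c d x : (c *: d) x = c *: d x. Proof. by []. Qed.

Lemma adE u x : ad u x = lie u x. Proof. by []. Qed.

Lemma Der_eq d e : d =1 e -> d = e.
Proof. by move=> de; apply/val_inj/funext. Qed.

Lemma ad_linear : linear (@ad F B).
Proof. by move=> c u v; apply: Der_eq => x /=; rewrite lie_linearl. Qed.

Lemma ad0 : ad (0 : B) = 0.
Proof. by apply: Der_eq => x; rewrite adE lie0l. Qed.

Lemma ad_sum (I : Type) (r : seq I) (f : I -> B) :
  ad (\sum_(i <- r) f i) = \sum_(i <- r) ad (f i).
Proof.
elim/big_rec2: _ => [|i d u _ <-]; first exact: ad0.
by rewrite -[f i]scale1r ad_linear !scale1r.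
Qed.

(** Undoes two inner corrections: all the [ad] terms collect into one by linearity of [ad]. *)
Lemma add_ad_eq d e c u v w : d - ad u - ad v = c *: (ad w + e) ->
  d = ad (c *: w + (u + v)) + c *: e.
Proof.
rewrite ad_linear -[in ad (u + v)](scale1r u) ad_linear scale1r => h.
by rewrite addrAC -scalerDr -h -[d - _ - _]addrA -opprD subrK.
Qed.

Lemma innerP d : reflect (exists u, d = ad u) (d \in inner_pred B).
Proof.
apply: (iffP idP); rewrite !inE; first by case=> u _ <-; exists u.
by case=> u ->; exists u.
Qed.

End DerivationTheory.

(** * The basis indexed by n = a + i, and coefficient formulas *)

Section Coordinates.
Variable F : fieldType.
Local Notation B := (algB F).
Implicit Types (x y : B) (n m z : int) (i j : nat).

(* L 0 0 acts on L a i by -(a + i); indexing by n = a + i turns the structure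
   constants into n (j + 1) - m (i + 1): this is the Poisson bracket
   {f, g} = x (f_x g_t - f_t g_x) with M n i = x^n t^(i + 1). *)
Definition M n i : B := L (n - i%:Z) i.

Lemma LE (a : int) i : L a i = M (a + i%:Z) i.
Proof. by rewrite /M addrK. Qed.

Lemma M_ind (P : B -> Prop) : P 0 -> (forall n i, P (M n i)) ->
  (forall c x y, P x -> P y -> P (c *: x + y)) -> forall x, P x.
Proof. by move=> P0 PM; apply: algB_ind => // a i; rewrite LE. Qed.

Lemma lieM n i m j : lie (M n i) (M m j) =
  (n * j.+1%:Z - m * i.+1%:Z)%:~R *: M (n + m) (i + j).
Proof.
rewrite /M lie_L PoszD opprD addrACA -/(M _ _).
have -> // : (n - i%:Z - 1) * j.+1%:Z - (m - j%:Z - 1) * i.+1%:Z =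
  n * j.+1%:Z - m * i.+1%:Z by rewrite !intS; ring.
Qed.

Lemma M_ext (f g : B -> F) :
  (forall c x y, f (c *: x + y) = c * f x + f y) ->
  (forall c x y, g (c *: x + y) = c * g x + g y) ->
  (forall n i, f (M n i) = g (M n i)) -> f =1 g.
Proof.
have h0 (h : B -> F) :
    (forall c x y, h (c *: x + y) = c * h x + h y) -> h 0 = 0.
  by move=> hl; have := hl (-1) 0 0; rewrite scaler0 addr0 mulN1r addNr.
move=> fl gl fg; elim/M_ind => [|//|c x y fgx fgy]; first by rewrite !h0.
by rewrite fl gl fgx fgy.
Qed.

(* The second index is an integer, with value 0 when negative, so that shifted
   coefficient formulas need no side conditions. *)
Definition Mcoef x n z : F := if z is Posz i then x@_(n - i%:Z, i) else 0.

Lemma McoefP c x y n z :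
  Mcoef (c *: x + y) n z = c * Mcoef x n z + Mcoef y n z.
Proof. by case: z => i /=; rewrite ?mcoeffD ?mcoeffZ ?mulr0 ?addr0. Qed.

Lemma Mcoef0 n z : Mcoef 0 n z = 0.
Proof. by case: z => i //=; rewrite mcoeff0. Qed.

Lemma McoefZ c x n z : Mcoef (c *: x) n z = c * Mcoef x n z.
Proof. by rewrite -[c *: x]addr0 McoefP Mcoef0 addr0. Qed.

Lemma McoefD x y n z : Mcoef (x + y) n z = Mcoef x n z + Mcoef y n z.
Proof. by rewrite -[x]scale1r McoefP mul1r scale1r. Qed.

Lemma McoefN x n z : Mcoef (- x) n z = - Mcoef x n z.
Proof. by rewrite -scaleN1r McoefZ mulN1r. Qed.

Lemma McoefB x y n z : Mcoef (x - y) n z = Mcoef x n z - Mcoef y n z.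
Proof. by rewrite McoefD McoefN. Qed.

Lemma McoefM m j n z : Mcoef (M m j) n z = ((n == m) && (z == j%:Z))%:R.
Proof.
case: z => i /=; last by rewrite andbF.
rewrite /M /L mcoeffU; congr (_%:R); congr nat_of_bool.
rewrite -pair_eqE /= eqz_nat [j == i]eq_sym [m - _ == _]eq_sym.
by have [->|_] := eqVneq i j; rewrite ?andbF // (inj_eq (addIr _)).
Qed.

Lemma Mcoef_inj x y : (forall n z, Mcoef x n z = Mcoef y n z) -> x = y.
Proof.
by move=> xy; apply/malgP=> -[a i]; have /= := xy (a + i%:Z) i; rewrite addrK.
Qed.

(** Bracketing with a basis vector translates both indices, so one coefficient of [x] contributes.
    If z < j none does, and [Mcoef] is 0 there by convention. *)
Lemma Mcoef_lier x m j n z : Mcoef (lie x (M m j)) n z =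
  ((n - m) * j.+1%:Z - m * (z - j%:Z + 1))%:~R * Mcoef x (n - m) (z - j%:Z).
Proof.
move: x; apply: M_ext => [c x y|c x y|k i].
- by rewrite (lie_linearl (M m j) c x y) McoefP.
- by rewrite McoefP mulrDr mulrCA.
- rewrite lieM McoefZ !McoefM.
  have -> : (n - m == k) = (n == k + m) by rewrite subr_eq.
  have -> : (z - j%:Z == i%:Z) = (z == (i + j)%N%:Z) by rewrite subr_eq PoszD.
  case: eqP => [->|_]; last by rewrite !mulr0.
  case: eqP => [->|_]; last by rewrite !mulr0.
  by rewrite !PoszD; congr (_%:~R * _); rewrite !intS; ring.
Qed.

Lemma Mcoef_liel x m j n z : Mcoef (lie (M m j) x) n z =
  (m * (z - j%:Z + 1) - (n - m) * j.+1%:Z)%:~R * Mcoef x (n - m) (z - j%:Z).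
Proof. by rewrite lie_antisym McoefN Mcoef_lier -mulNr -rmorphN opprB. Qed.

Lemma Mcoef_d0 x n z : Mcoef (d0 F x) n z = (n - z)%:~R * Mcoef x n z.
Proof.
move: x; apply: M_ext => [c x y|c x y|k i].
- by rewrite der_linear McoefP.
- by rewrite McoefP mulrDr mulrCA.
- rewrite /= d0_funL McoefZ McoefM.
  by case: eqP => [->|_]; [case: eqP => [->|_]|]; rewrite ?mulr0.
Qed.

(** Rescales each coefficient by [g] and lowers n by m. Bracketing with [M 0 0] or [M 1 0] has this
    shape up to the sign of the shift, so such maps serve to solve [u, M m 0] = y for u. *)
Definition diagM m (g : int -> int -> F) : B -> B :=
  lext (fun k => g (k.1 + k.2%:Z) k.2 *: M (k.1 + k.2%:Z - m) k.2).

Lemma Mcoef_diagM m g x n z :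
  Mcoef (diagM m g x) n z = g (n + m) z * Mcoef x (n + m) z.
Proof.
move: x; apply: M_ext => [c x y|c x y|k i].
- by rewrite /diagM lext_linear McoefP.
- by rewrite McoefP mulrDr mulrCA.
- rewrite /diagM lextU /= subrK McoefZ !McoefM eq_sym subr_eq eq_sym.
  by case: eqP => [->|_]; [case: eqP => [->|_]|]; rewrite ?mulr0.
Qed.

End Coordinates.

(** * The recurrence on coefficients in characteristic zero *)

Section CharacteristicZero.
Variables (F : fieldType) (charF : [pchar F] =i pred0).
Local Notation B := (algB F).

Lemma pchar0_intr_eq0 (z : int) : (z%:~R == 0 :> F) = (z == 0).
Proof.
by case: z => n; rewrite ?NegzE ?rmorphN ?oppr_eq0 -?pmulrn (pcharf0P F).1.
Qed.

Lemma intr_mulfI (z : int) (x : F) : z != 0 -> z%:~R * x = 0 -> x = 0.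
Proof.
by move=> z0 /eqP; rewrite mulf_eq0 pchar0_intr_eq0 (negPf z0) => /eqP.
Qed.

Section Recurrence.
(* E m i stands for the coefficient of M m (i + s) in d (M m i). *)
Variables (s : int) (E : int -> nat -> F).
Hypothesis E_rec : forall (m : int) i (n : int) j,
  (m * j.+1%:Z - n * i.+1%:Z)%:~R * E (m + n) (i + j) =
  (m * j.+1%:Z - n * (i%:Z + s + 1))%:~R * E m i +
  (m * (j%:Z + s + 1) - n * i.+1%:Z)%:~R * E n j.
Hypothesis E00 : E 0 0 = 0.
Hypothesis E10 : E 1 0 = 0.

(** Lets known values be substituted when the indices agree only after simplification, as in [m - m]
    or [1 + 1]. *)
Lemma E_rec_eq (m n : int) i j x y z :
  E (m + n) (i + j) = x -> E m i = y -> E n j = z ->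
  (m * j.+1%:Z - n * i.+1%:Z)%:~R * x =
  (m * j.+1%:Z - n * (i%:Z + s + 1))%:~R * y +
  (m * (j%:Z + s + 1) - n * i.+1%:Z)%:~R * z.
Proof. by move=> <- <- <-. Qed.

(** In row 0 the values at -1 and 2 come first, then all m > 2 by adding 1, and negative m by
    symmetry. The bound on s keeps the divisors s + 2 and s + 3 nonzero. *)
Lemma recurrence_row0 : 0 <= s -> forall m, E m 0 = 0.
Proof.
move=> s0.
have EN (m : int) : E m 0 = 0 -> E (- m) 0 = 0.
  have [->|m0 Em] := eqVneq m 0; first by rewrite oppr0.
  apply: (@intr_mulfI (m * (s + 2))); first by rewrite mulf_neq0 //; lia.
  have E0 : E (m - m) 0 = 0 by rewrite subrr.
  have := @E_rec_eq m (- m) 0 0 _ _ _ E0 Em erefl.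
  rewrite !mulr0 add0r => ->; congr (_%:~R * _); ring.
have EN1 : E (- 1) 0 = 0 := EN 1 E10.
(* The pair 1 + 1 = 2 says nothing, its left factor being 0; 2 + (-1) = 1 is used instead. *)
have E20 : E 2 0 = 0.
  apply: (@intr_mulfI (s + 3)); first lia.
  have := @E_rec_eq 2 (- 1) 0 0 0 _ _ E10 erefl EN1.
  by rewrite !mulr0 addr0 => ->; congr (_%:~R * _); ring.
have Epos (k : nat) : E k.+2%:Z 0 = 0.
  elim: k => // k IHk; apply: (@intr_mulfI k.+1); first lia.
  have := @E_rec_eq k.+2%:Z 1 0 0 _ _ _ erefl IHk E10.
  rewrite !mulr0 addr0 addn0 => <-.
  by congr (_%:~R * E _ _); lia.
have Enat (k : nat) : E k 0 = 0 by case: k => [|[|k]].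
by case=> k; rewrite ?NegzE ?EN ?Enat.
Qed.

(** For m != 0, [E m i] is linear in i with a slope H independent of m. The pair (1, 1), (1, 0) then
    gives s H = 0, and the pair (1, i), (-1, 0) recovers the column m = 0. *)
Lemma recurrence_solution : (forall m, E m 0 = 0) ->
  forall m i, E m i = if s == 0 then i%:R * E 1 1 else 0.
Proof.
move=> Em0.
have [H Eh] : exists H, forall (m : int) i, m != 0 -> E m i = i%:R * H.
  (* The pair (m, i), (0, 1) reads 2 m (E m (i + 1) - E m i) = m (s + 2) E 0 1. *)
  exists ((s + 2)%:~R / 2%:~R * E 0 1) => m i m0.
  elim: i => [|i IHi]; first by rewrite Em0 mul0r.
  apply/eqP; rewrite -subr_eq0; apply/eqP.
  apply: (@intr_mulfI (2 * m)); first by rewrite mulf_neq0.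
  have Emi1 : E (m + 0) (i + 1) = E m i.+1 by rewrite addr0 addn1.
  have := @E_rec_eq m 0 i 1 _ _ _ Emi1 IHi erefl.
  rewrite !mul0r !subr0 [2 * m]mulrC mulrBr => ->.
  have c0 : 2%:~R != 0 :> F by rewrite pchar0_intr_eq0.
  rewrite -addn1 natrD !rmorphM !rmorphD /=; field.
  exact: c0.
have E11 : E 1 1 = H by rewrite Eh // mul1r.
have sH : s%:~R * H = 0.
  have E21 : E (1 + 1) (1 + 0) = H by rewrite Eh // mul1r.
  have := @E_rec_eq 1 1 1 0 _ _ _ E21 E11 (Em0 1).
  rewrite mulr0 addr0 => /eqP; rewrite -subr_eq0 -mulrBl -rmorphB => /eqP <-.
  by congr (_%:~R * _); ring.
have H0 : s != 0 -> H = 0 by move=> s0; apply: intr_mulfI sH.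
move=> m i; have [->|m0] := eqVneq m 0; last first.
  by rewrite Eh // E11; have [//|/H0->] := eqVneq s 0; rewrite mulr0.
have E0i : E (1 - 1) (i + 0) = E 0 i by rewrite subrr addn0.
have := @E_rec_eq 1 (- 1) i 0 _ _ _ E0i (Eh 1 i isT) (Em0 (-1)).
rewrite mulr0 addr0 E11.
have [->|/H0->] := eqVneq s 0; last first.
  by rewrite !mulr0 => /intr_mulfI->//; lia.
move=> h; apply/eqP; rewrite -subr_eq0; apply/eqP.
apply: (@intr_mulfI (i%:Z + 2)); first lia.
rewrite mulrBr; move/eqP: h; rewrite -subr_eq0 => /eqP <-.
by congr (_%:~R * _ - _%:~R * _); lia.
Qed.

End Recurrence.

End CharacteristicZero.

(** * Inner derivations and multiples of [d0] *)

Section Decomposition.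
Variables (F : fieldType) (charF : [pchar F] =i pred0).
Local Notation B := (algB F).
Local Notation M := (M F).
Local Notation Mcoef := (Mcoef F).
Implicit Types (d : Der B) (m n z : int) (i j : nat).

Lemma Mcoef_der_lie d m n (a z : int) i j :
  (m * j.+1%:Z - n * i.+1%:Z)%:~R * Mcoef (d (M (m + n) (i + j))) a z =
  ((a - n) * j.+1%:Z - n * (z - j%:Z + 1))%:~R *
    Mcoef (d (M m i)) (a - n) (z - j%:Z) +
  (m * (z - i%:Z + 1) - (a - m) * i.+1%:Z)%:~R *
    Mcoef (d (M n j)) (a - m) (z - i%:Z).
Proof.
rewrite -McoefZ -derZ -lieM derM McoefD.
congr (_ + _); first exact: Mcoef_lier.
exact: Mcoef_liel.
Qed.

(** Apply [d] to [M 0 0, M m j] = -m M m j: the n-coefficients of [d (M m j)], times n - m, are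
    those of [d (M 0 0), M m j]. The latter vanish for n != m; for n = m the left side is 0, and
    [M 1 0] then kills what is left of [d (M 0 0)]. *)
Lemma der_degree d : (forall n z, n != 0 -> Mcoef (d (M 0 0)) n z = 0) ->
  d (M 0 0) = 0 /\ forall m j n z, n != m -> Mcoef (d (M m j)) n z = 0.
Proof.
move=> dt.
have key m j n z : (n - m)%:~R * Mcoef (d (M m j)) n z =
    ((n - m) * j.+1%:Z - m * (z - j%:Z + 1))%:~R *
      Mcoef (d (M 0 0)) (n - m) (z - j%:Z).
  have h := Mcoef_der_lie d 0 m n z 0 j; rewrite (add0r m) !subr0 in h.
  move: (Mcoef (d (M m j)) n z) (Mcoef (d (M 0 0)) _ _) h => p q h.
  rewrite -[RHS](addrK ((0 * (z + 1) - n * 1%:Z)%:~R * p)) -h -mulrBl -rmorphB.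
  by congr (_%:~R * _); ring.
split=> [|m j n z nm]; last first.
  apply: (@intr_mulfI F charF (n - m)); first by rewrite subr_eq0.
  by rewrite key dt ?mulr0 // subr_eq0.
apply: Mcoef_inj => n z; rewrite Mcoef0.
have [->|n0] := eqVneq n 0; last exact: dt.
case: z => // i; apply: (@intr_mulfI F charF (- i.+1%:Z)); first lia.
have := key 1 0%N 1 i; rewrite subrr mul0r subr0 => ->.
by congr (_%:~R * _); lia.
Qed.

Lemma der_normalized d :
  (forall n z, n != 0 -> Mcoef (d (M 0 0)) n z = 0) ->
  (forall z, Mcoef (d (M 1 0)) 1 z = 0) ->
  exists c, d = c *: (ad (M 0 0) + d0 F).
Proof.
move=> /der_degree[dt deg] dx.
pose E (s m : int) i := Mcoef (d (M m i)) m (i%:Z + s).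
(* [ad (M 0 0) + d0 F] multiplies [M m i] by -i, whereas [d] will turn out to multiply it by i times
   [E 0 1 1]. *)
exists (- E 0 1 1%N); apply: Der_eq => x; apply: Mcoef_inj => n z.
rewrite scaleDerE McoefZ addDerE McoefD adE Mcoef_liel Mcoef_d0 !subr0.
move: x; apply: M_ext => [a x y|a x y|m i].
- by rewrite der_linear McoefP.
- rewrite McoefP; move: (Mcoef x n z) (Mcoef y n z) => p q; ring.
rewrite -mulrDl -rmorphD mulNr -mulrN -mulNr -rmorphN mulrA.
have -> : - (0 * (z + 1) - n * 1%:Z + (n - z)) = z by ring.
have [->|nm] := eqVneq n m; last by rewrite deg // McoefM (negPf nm) mulr0.
rewrite McoefM eqxx /=.
have {1}-> : z = i%:Z + (z - i%:Z) by ring.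
rewrite -/(E (z - i%:Z) m i).
set s := z - i%:Z.
have E_rec (m' : int) i' (n' : int) j' :
  (m' * j'.+1%:Z - n' * i'.+1%:Z)%:~R * E s (m' + n') (i' + j')%N =
  (m' * j'.+1%:Z - n' * (i'%:Z + s + 1))%:~R * E s m' i' +
  (m' * (j'%:Z + s + 1) - n' * i'.+1%:Z)%:~R * E s n' j'.
  have := Mcoef_der_lie d m' n' (m' + n') ((i' + j')%N%:Z + s) i' j'.
  rewrite addrK.
  have -> : (i' + j')%N%:Z + s - j'%:Z = i'%:Z + s by lia.
  have -> : (i' + j')%N%:Z + s - i'%:Z = j'%:Z + s by lia.
  by have -> : m' + n' - m' = n' by ring.
have E00 : E s 0 0%N = 0 by rewrite /E dt Mcoef0.
have E10 : E s 1 0%N = 0 by rewrite /E dx.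
have Em0 (m' : int) : E s m' 0%N = 0.
  (* For s < 0 the shifted index 0 + s is negative, so row 0 vanishes by the convention on
     [Mcoef]. *)
  have [s0|s0] := boolP (0 <= s); first exact: (recurrence_row0 F charF s).
  by rewrite /E add0r; case: (s) s0.
rewrite (recurrence_solution F charF s _ E_rec Em0) /s subr_eq0.
case: eqP => [->|_]; last by rewrite mulr0.
by rewrite subrr mulr1 mulrC pmulrn.
Qed.

Lemma derivation_decomposition d : exists u c, d = ad u + c *: d0 F.
Proof.
(* [u, M 0 0] multiplies the n-coefficients of u by n. At n = 0 the inverse is 0, so [u1] has no
   component there. *)
pose u1 := diagM F 0 (fun n _ => n%:~R^-1) (d (M 0 0)).
pose e1 := d - ad u1.
have e1t n z : n != 0 -> Mcoef (e1 (M 0 0)) n z = 0.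
  move=> n0; rewrite subDerE McoefB Mcoef_lier Mcoef_diagM !subr0 mulr1.
  by rewrite mul0r subr0 mulVKf ?subrr // pchar0_intr_eq0.
(* For u with n = 0, [u, M 1 0] has n = 1 and its z-coefficient is -(z + 1) times that of u. Such u
   commutes with [M 0 0], so the first normalization survives. *)
pose u2 := diagM F 1 (fun n z => if n == 1 then - (z + 1)%:~R^-1 else 0)
  (e1 (M 1 0)).
pose e := e1 - ad u2.
have et n z : n != 0 -> Mcoef (e (M 0 0)) n z = 0.
  move=> n0; rewrite subDerE McoefB e1t // Mcoef_lier Mcoef_diagM !subr0.
  have -> : (n + 1 == 1) = false by lia.
  by rewrite !mul0r mulr0 subrr.
have ex z : Mcoef (e (M 1 0)) 1 z = 0.
  rewrite subDerE McoefB; case: z => [i|i]; last by rewrite /= subrr.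
  rewrite Mcoef_lier Mcoef_diagM.
  have -> : 1 - 1 + 1 = 1 :> int by [].
  have -> : (1 - 1) * 1%:Z - 1 * (i%:Z - 0%:Z + 1) = - (i%:Z + 1) by ring.
  rewrite subr0 mulrA rmorphN /= mulrNN divff ?mul1r ?subrr //.
  by rewrite pchar0_intr_eq0 //; lia.
have [c eE] := der_normalized e et ex.
by exists (c *: M 0 0 + (u1 + u2)), c; apply: add_ad_eq.
Qed.

(* On L 1 0 = M 1 0 and L 0 1 = M 1 1 the diagonal coefficients of ad u are both
   minus the coefficient of L 0 0 in u, and those of d0 are 1 and 0. *)
Definition d0_coord d : F := Mcoef (d (M 1 0)) 1 0 - Mcoef (d (M 1 1)) 1 1.

Lemma d0_coordP c d e : d0_coord (c *: d + e) = c * d0_coord d + d0_coord e.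
Proof.
have key m i z : Mcoef ((c *: d + e) (M m i)) m z =
    c * Mcoef (d (M m i)) m z + Mcoef (e (M m i)) m z.
  by rewrite addDerE scaleDerE McoefP.
rewrite /d0_coord mulrBr addrACA -opprD.
by congr (_ - _); apply: key.
Qed.

Lemma d0_coord_ad u : d0_coord (ad u) = 0.
Proof.
have key i : Mcoef (ad u (M 1 i)) 1 i%:Z = - Mcoef u 0 0.
  by rewrite adE Mcoef_lier !subrr mul0r sub0r add0r mul1r mulN1r.
by rewrite /d0_coord -[RHS](subrr (- Mcoef u 0 0)); congr (_ - _); apply: key.
Qed.

Lemma d0_coord_d0 : d0_coord (d0 F) = 1.
Proof.
have key i : Mcoef (d0 F (M 1 i)) 1 i%:Z = (1 - i%:Z)%:~R.
  by rewrite Mcoef_d0 McoefM !eqxx mulr1.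
by rewrite -[RHS]subr0 /d0_coord; congr (_ - _); apply: key.
Qed.

Lemma d0_coord_decomposition u c : d0_coord (ad u + c *: d0 F) = c.
Proof.
by rewrite [ad u + _]addrC d0_coordP d0_coord_ad d0_coord_d0 mulr1 addr0.
Qed.

Lemma inner_d0_coord d : (d \in inner_pred B) = (d0_coord d == 0).
Proof.
apply/innerP/eqP => [[u ->]|]; first exact: d0_coord_ad.
have [u [c ->]] := derivation_decomposition d.
rewrite d0_coord_decomposition => ->.
by exists u; rewrite scale0r addr0.
Qed.

Lemma inner_complement d : d - d0_coord d *: d0 F \in inner_pred B.
Proof.
rewrite inner_d0_coord addrC -scaleNr d0_coordP d0_coord_d0.
by rewrite mulr1 addNr.
Qed.

Lemma span_d0P d : D F d <-> exists c, d = c *: d0 F.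
Proof.
split=> [[s ->]|[c ->]]; last by exists [:: (c, tt)]; rewrite big_seq1.
by exists (\sum_(p <- s) p.1); rewrite scaler_suml.
Qed.

Lemma direct_sum_inner_d0 : direct_sum2 (adB B) (D F).
Proof.
move=> d; exists (d - d0_coord d *: d0 F, d0_coord d *: d0 F); split=> /=.
  split; last by rewrite subrK.
  - by have := inner_complement d; rewrite inE.
  - by apply/span_d0P; exists (d0_coord d).
(* Uniqueness: [d0_coord] reads off c from any decomposition. *)
move=> [e f] /= [[u _ <-]] /span_d0P[c ->] ->.
by rewrite d0_coord_decomposition addrK.
Qed.

Lemma dim_H1 : has_dim (H1 B) 1.
Proof.
pose f (x : H1 B) : 'rV[F]_1 :=
  const_mx (d0_coord (repr (x : Quotient.quot (quot_pred (inner_pred B))))).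
(* Independence of the representative: [d0_coord] kills the inner derivations. *)
have f_pi d : f (quotmod_pi (inner_pred B) d) = const_mx (d0_coord d).
  congr const_mx; apply/eqP; rewrite -subr_eq0 addrC -mulN1r -d0_coordP.
  rewrite -inner_d0_coord scaleN1r addrC; apply/quotmod_piP.
  by rewrite quotmod_repr.
have f_lin : linear f.
  move=> a x y; rewrite -[x]quotmod_repr -[y]quotmod_repr.
  rewrite -[a *: _](quotmod_piZ (inner_pred B) a) -quotmod_piD !f_pi.
  by apply/rowP => i; rewrite !mxE d0_coordP.
pose fM := GRing.isLinear.Build F (H1 B) 'rV[F]_1 *:%R f f_lin.
pose fL : {linear H1 B -> 'rV[F]_1} := HB.pack f fM.
pose g (v : 'rV[F]_1) : H1 B := quotmod_pi (inner_pred B) (v 0 0 *: d0 F).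
exists fL; apply: (@Bijective _ _ _ g) => [x|v].
  rewrite -[x]quotmod_repr [fL _]f_pi /g mxE; apply/quotmod_piP.
  by rewrite -opprB rpredN inner_complement.
rewrite [fL _]f_pi; apply/rowP => i; rewrite mxE ord1.
by rewrite -[_ *: _]add0r -ad0 d0_coord_decomposition.
Qed.

End Decomposition.

(** * Closure and induction for spans *)

Section Span.
Variables (F : fieldType) (V : lmodType F) (I : Type) (v : I -> V).

Lemma span0 : Defs.span v 0.
Proof. by exists [::]; rewrite big_nil. Qed.

Lemma mem_span i : Defs.span v (v i).
Proof. by exists [:: (1, i)]; rewrite big_seq1 scale1r. Qed.

Lemma spanP c x y : Defs.span v x -> Defs.span v y -> Defs.span v (c *: x + y).
Proof.
move=> [s ->] [t ->]; exists ([seq (c * p.1, p.2) | p <- s] ++ t).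
rewrite big_cat big_map scaler_sumr; congr (_ + _).
by apply: eq_bigr => p _; rewrite scalerA.
Qed.

Lemma spanZ c x : Defs.span v x -> Defs.span v (c *: x).
Proof.
by move=> vx; rewrite -[c *: x]addr0; apply: spanP => //; apply: span0.
Qed.

Lemma spanB x y : Defs.span v x -> Defs.span v y -> Defs.span v (x - y).
Proof. by move=> vx vy; rewrite addrC -scaleN1r; apply: spanP. Qed.

Lemma spanD x y : Defs.span v x -> Defs.span v y -> Defs.span v (x + y).
Proof. by move=> vx vy; rewrite -[x]scale1r; apply: spanP. Qed.

Lemma span_ind (P : V -> Prop) : P 0 -> (forall i, P (v i)) ->
  (forall c x y, P x -> P y -> P (c *: x + y)) ->
  forall x, Defs.span v x -> P x.
Proof.
by move=> P0 Pv PP x [s ->]; elim/big_rec: _ => // p y _; apply: PP.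
Qed.

End Span.

(** * The grading of the derivation algebra *)

Section Grading.
Variable F : fieldType.
Local Notation B := (algB F).
Implicit Types (d : Der B) (a b : int) (x y u : B).

Lemma B_ind a (P : B -> Prop) : P 0 -> (forall i, P (L a i)) ->
  (forall c x y, P x -> P y -> P (c *: x + y)) -> forall x, B_ F a x -> P x.
Proof. exact: span_ind. Qed.

Lemma lie_B_ a b x y : B_ F a x -> B_ F b y -> B_ F (a + b) (lie x y).
Proof.
move=> ax by_.
have step c (x1 x2 : B) : B_ F (a + b) (lie x1 y) -> B_ F (a + b) (lie x2 y) ->
    B_ F (a + b) (lie (c *: x1 + x2) y).
  by rewrite (lie_linearl y c x1 x2); apply: spanP.
move: x ax; apply: B_ind => [|i|c x1 x2]; last exact: step.
  by rewrite lie0l; apply: span0.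
move: {step} y by_; apply: B_ind => [|j|c y1 y2].
- by rewrite lie0r; apply: span0.
- by rewrite lie_L; apply: spanZ; apply: mem_span.
- by rewrite (lie_linearr (L a i : B) c y1 y2); apply: spanP.
Qed.

Lemma Der_comm a b d e :
  Der_ F a d -> Der_ F b e -> Der_ F (a + b) (der_comm d e).
Proof.
move=> da eb k x kx; apply: spanB.
  by rewrite -addrA; apply/da/eb.
by rewrite [a + b]addrC -addrA; apply/eb/da.
Qed.

Lemma Der_ad a u : B_ F a u -> Der_ F a (ad u).
Proof. by move=> au b x; apply: lie_B_. Qed.

Lemma Der_d0 : Der_ F 0 (d0 F).
Proof.
move=> b; rewrite add0r; apply: B_ind => [|i|c x y].
- by rewrite der0; apply: span0.
- by rewrite [d0 F _]d0_funL; apply: spanZ; apply: mem_span.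
- by rewrite der_linear; apply: spanP.
Qed.

Definition projB a : B -> B :=
  lext (fun k => if k.1 == a then L k.1 k.2 else 0).

Lemma projB_linear a : linear (projB a).
Proof. exact: lext_linear. Qed.

Lemma projB_L a b i : projB a (L b i) = if b == a then L b i else 0.
Proof. exact: lextU. Qed.

Lemma projB0 a : projB a 0 = 0.
Proof. by have := linZ (projB_linear a) 0 0; rewrite !scale0r. Qed.

Lemma projB_B_ a x : B_ F a (projB a x).
Proof.
elim/algB_ind: x => [|b i|c x y IHx IHy].
- by rewrite projB0; apply: span0.
- rewrite projB_L; case: eqP => [->|_]; first exact: mem_span.
  exact: span0.
- by rewrite projB_linear; apply: spanP.
Qed.

Lemma projB_id a b x : B_ F b x -> projB a x = if b == a then x else 0.
Proof.
move: x; apply: B_ind => [|i|c x y IHx IHy]; first by rewrite projB0 if_same.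
  exact: projB_L.
by rewrite projB_linear IHx IHy; case: eqP => //; rewrite scaler0 addr0.
Qed.

(** Allowing every larger [T] lets two vectors share one index set in the induction, and later lets
    degree 0 be added. *)
Lemma projB_sum x : exists S : {fset int}, forall T : {fset int},
  (S `<=` T)%fset -> x = \sum_(a <- T) projB a x.
Proof.
elim/algB_ind: x => [|b i|c x y [S Sx] [S' Sy]].
- by exists fset0 => T _; rewrite big1 // => a _; apply: projB0.
- exists [fset b]%fset => T; rewrite fsub1set => bT.
  rewrite (big_fsetD1 b) //= projB_L eqxx big1_seq ?addr0 // => a.
  by rewrite !inE projB_L eq_sym => /andP[_ /andP[/negPf->]].
- exists (S `|` S')%fset => T; rewrite fsubUset => /andP[ST S'T].
  rewrite [in LHS](Sx T ST) [in LHS](Sy T S'T) scaler_sumr -big_split.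
  by apply: eq_bigr => a _; rewrite projB_linear.
Qed.

Lemma Der_ext (d e : Der B) : (forall a i, d (L a i) = e (L a i)) -> d = e.
Proof.
move=> de; apply: Der_eq; elim/algB_ind => [|//|c x y dex dey].
  by rewrite !der0.
by rewrite !der_linear dex dey.
Qed.

Lemma sumDerE (I : Type) (r : seq I) (f : I -> Der B) x :
  (\sum_(i <- r) f i) x = \sum_(i <- r) f i x.
Proof. by elim/big_rec2: _ => // i y e _ <-. Qed.

(** Uniqueness of homogeneous components: on [L b i] the k-th one lands in degree k + b, so
    projecting to a + b isolates k = a. *)
Lemma graded_component (c : {fsfun int -> Der B with 0}) :
  (forall a, Der_ F a (c a)) -> forall a b i,
  projB (a + b) ((\sum_(k <- finsupp c) c k) (L b i)) = c a (L b i).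
Proof.
move=> cD a b i.
rewrite sumDerE (big_morph (projB (a + b)) (id1 := 0) (op1 := +%R)).
- have E k : projB (a + b) (c k (L b i)) = if k == a then c k (L b i) else 0.
    rewrite (@projB_id _ (k + b)); last exact/cD/mem_span.
    by rewrite (inj_eq (addIr b)).
  rewrite (eq_bigr _ (fun k _ => E k)).
  have [ac|ac] := boolP (a \in finsupp c).
    rewrite (big_fsetD1 a) //= eqxx big1_seq ?addr0 // => k.
    by rewrite !inE => /andP[_ /andP[/negPf->]].
  rewrite fsfun_dflt // big1_seq // => k /andP[_ kc].
  by case: eqP => // ka; rewrite -ka kc in ac.
- by move=> x y; rewrite -[x]scale1r projB_linear !scale1r.
- exact: projB0.
Qed.

(** That finitely many components suffice comes from d = ad u + k d0: u has finitely many
    homogeneous components, and [d0] has degree 0. *)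
Lemma direct_sum_Der_ : [pchar F] =i pred0 -> direct_sum (Der_ F).
Proof.
move=> charF d.
have [u [k dE]] := derivation_decomposition F charF d.
have [S Su] := projB_sum u.
(* Degree 0 is put in to carry the [d0] term even when it is missing from [S]. *)
pose T := (0 |` S)%fset.
pose f a := ad (projB a u) + if a == 0 then k *: d0 F else 0.
pose c : {fsfun int -> Der B with 0} := [fsfun a in T => f a | 0].
have cE a : c a = if a \in T then f a else 0 by rewrite fsfunE.
have cD a : Der_ F a (c a).
  rewrite cE; case: ifP => _ b x bx; last exact: span0.
  apply: spanD; first exact: (Der_ad _ _ (projB_B_ a u)).
  case: eqP => [->|_]; last exact: span0.
  by apply: spanZ; apply: Der_d0.
have cS : d = \sum_(a <- finsupp c) c a.
  (* The support of [c] may be smaller than [T], since some [f a] can vanish. *)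
  have -> : \sum_(a <- finsupp c) c a = \sum_(a <- T) f a.
    rewrite (@big_fset_incl _ _ _ _ _ T); last by move=> a _ /fsfun_dflt.
      by apply: eq_big_seq => a aT; rewrite cE aT.
    by apply/fsubsetP => a; rewrite mem_finsupp cE; case: ifP; rewrite ?eqxx.
  rewrite dE big_split -ad_sum -Su ?fsubsetUr //; congr (_ + _).
  rewrite (big_fsetD1 0) ?inE //= big1_seq ?addr0 // => a.
  by rewrite !inE => /andP[_ /andP[/negPf->]].
exists c; split=> [//|c' [c'D c'S]]; apply/fsfunP => a; apply: Der_ext => b i.
by rewrite -(graded_component c cD) -cS c'S (graded_component c' c'D).
Qed.

End Grading.

Theorem theorem2p1 (F : closedFieldType) (charF : [pchar F] =i pred0) :
  [/\ direct_sum (Der_ F),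
      (forall (a b : int) (d e : Der (algB F)),
         Der_ F a d -> Der_ F b e -> Der_ F (a + b) (der_comm d e)),
      (forall (b : int) (j : nat), d0 F (L b j) = b%:~R *: L b j),
      direct_sum2 (adB (algB F)) (D F)
    & has_dim (H1 (algB F)) 1].
Proof.
split.
- exact: direct_sum_Der_.
- exact: Der_comm.
- exact: d0_funL.
- exact: direct_sum_inner_d0.
- exact: dim_H1.
Qed.
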